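(* Let $n=2m>3$ be an even integer and let $a,b$ be natural numbers with $1\le a<b\le n-1$. If $\gcd(a+b,n)>2$, then $a$ and $b$ do not induce an $n$-polygon with $m$ axes, i.e. the $n$-tuple of sides $(a,b,a,b,\ldots,a,b)$ does not represent an $n$-polygon with $m$ axes.
   Context: Fix the vertices $v_k=e^{2\pi i k/n}$, $k=0,\ldots,n-1$, on the unit circle. An $n$-polygon is a Hamiltonian cycle through these vertices: a closed path $v_{\sigma_1}\cdots v_{\sigma_n}v_{\sigma_1}$ of straight segments with $(\sigma_1,\ldots,\sigma_n)$ an ordering of $0,\ldots,n-1$. Its sides are the integers $e_i\in\{1,\ldots,n-1\}$ with $e_i\equiv\sigma_{i+1}-\sigma_i\pmod n$; an $n$-tuple of sides represents a polygon if starting at a vertex and moving counterclockwise successively by the sides visits each vertex exactly once before returning to the start after the $n$-th step. An $n$-polygon with $m$ axes is one with exactly $m$ axes of reflection symmetry. *)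

(* Defs.v *)
(* The Euclidean plane is R[i], for R : realType. *)
From HB Require Import structures.
From mathcomp Require Import all_boot all_order all_algebra all_fingroup.
From mathcomp Require Import all_classical all_reals all_analysis.
From mathcomp Require Import complex.
Set Implicit Arguments.
Unset Strict Implicit.
Unset Printing Implicit Defensive.
Import Order.TTheory GRing.Theory Num.Theory.
Local Open Scope classical_set_scope.
Local Open Scope ring_scope.
Local Open Scope complex_scope.

Definition vertex (R : realType) (n k : nat) : R[i] :=
  let theta : R := 2 * pi * k%:R / n%:R in cos theta +i* sin theta.

Definition segment (R : realType) (z w : R[i]) : set R[i] :=
  [set (1 - t)%:C * z + t%:C * w | t in [set t : R | 0 <= t <= 1]].

Definition line (R : realType) (p d : R[i]) : set R[i] :=
  [set p + t%:C * d | t in [set: R]].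

(* For d != 0 this depends only on the set [line p d], not on p and d. *)
Definition reflection (R : realType) (p d z : R[i]) : R[i] :=
  p + d / d^* * (z - p)^*.

(* An ordering of the vertices, i.e. the Hamiltonian cycle
   v_(s 0) v_(s 1) ... v_(s (n - 1)) v_(s 0).  The successor [ordS] is cyclic,
   so that the closing side is included in the figure. *)
Definition polygon (n : nat) := {perm 'I_n}.

Definition figure (R : realType) (n : nat) (s : polygon n) : set R[i] :=
  \bigcup_(i in [set: 'I_n])
    segment (vertex R n (s i)) (vertex R n (s (ordS i))).
Arguments figure R {n} s.

Definition axes (R : realType) (n : nat) (s : polygon n) : set (set R[i]) :=
  [set L | exists p d : R[i],
    [/\ d != 0, L = line p d & reflection p d @` figure R s = figure R s]].
Arguments axes R {n} s.

Definition has_axes (R : realType) (n : nat) (s : polygon n) (m : nat) : Prop :=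
  (axes R s #= `I_m)%card.

(* Index of the vertex reached from v_v0 after k counterclockwise moves. *)
Definition walk (n : nat) (e : n.-tuple nat) (v0 k : nat) : nat :=
  ((v0 + sumn (take k e)) %% n)%N.

(* Each vertex is visited exactly once during the first n positions because
   s is a permutation. *)
Definition represents (n : nat) (e : n.-tuple nat) (s : polygon n) : Prop :=
  all (fun x => (1 <= x <= n - 1)%N) e /\
  exists v0 : 'I_n,
    (forall i : 'I_n, val (s i) = walk e v0 i) /\ walk e v0 n = v0.

Definition represents_with_axes (R : realType) (n : nat) (e : n.-tuple nat)
    (m : nat) : Prop :=
  exists s : polygon n, represents e s /\ has_axes R s m.

(* (a, b, a, b, ...), starting with a. *)
Definition alternating_sides (n a b : nat) : n.-tuple nat :=
  [tuple (if odd i then b else a) | i < n].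

(* Main.v *)
(* The side pair (a, b) moves by a + b, whose order in Z/n is n / gcd (a + b, n).
   So the walk is back at its start after 2 n / gcd (a + b, n) < n moves, and it
   is not Hamiltonian. *)
Require Import Defs.
From mathcomp Require Import all_boot all_order all_algebra all_fingroup.
From mathcomp Require Import all_classical all_reals all_analysis.
From mathcomp Require Import complex.

(** Let [g = gcdn (a + b) n] and [q = n / g]. By [sumn_take_alternating_sides], [2 * q] moves
    advance by [q * (a + b)], a multiple of [q * g = n]. As [g > 2], the indices [0] and [2 * q < n]
    are distinct yet carry the same vertex, so no permutation is represented. *)

Lemma sumn_take_alternating_sides (n a b k : nat) (hk : (2 * k <= n)%N) :
  sumn (take (2 * k) (alternating_sides n a b)) = (k * (a + b))%N.
Proof.
(* As a map over [iota], the tuple has prefixes that are maps over shorter [iota]s. *)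
have -> : val (alternating_sides n a b)
          = mkseq (fun i => if odd i then b else a) n.
  by rewrite /= /mkseq -val_enum_ord -map_comp.
rewrite /mkseq -map_take take_iota (minn_idPl hk) {hk}.
elim: k => [|k IHk]; first by rewrite muln0 mul0n.
(* The last pair is split off; it starts at the even index [2 * k], hence is [a, b]. *)
rewrite mulnS addnC iotaD map_cat sumn_cat IHk add0n /= mul2n odd_double.
by rewrite addn0 mulSn addnC.
Qed.

Lemma alternating_sides_not_represents (n a b : nat) (s : polygon n)
    (hn : (0 < n)%N) (hgcd : (2 < gcdn (a + b) n)%N) :
  ~ represents (alternating_sides n a b) s.
Proof.
case=> _ [v0 [walkE _]].
set g := gcdn (a + b) n in hgcd.
have qg : (n %/ g * g)%N = n by rewrite divnK // dvdn_gcdr.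
set q := (n %/ g)%N in qg.
have q_gt0 : (0 < q)%N by move: hn; rewrite -qg muln_gt0 => /andP[].
have q2_lt : (2 * q < n)%N by rewrite -[ltnRHS]qg mulnC ltn_pmul2l.
have back : (q * (a + b) %% n = 0)%N.
  by apply/eqP; rewrite -/(dvdn _ _) -[X in (X %| _)%N]qg dvdn_pmul2l // dvdn_gcdl.
(* Injectivity of [s] forces [2 * q = 0], against [q > 0]. *)
have /perm_inj /(congr1 val) /= q2_eq0 :
    s (Ordinal q2_lt) = s (Ordinal hn).
  apply: val_inj; rewrite !walkE /walk /= take0 addn0.
  rewrite sumn_take_alternating_sides; last exact: ltnW.
  by rewrite -modnDmr back addn0.
by move: q_gt0; case: (q) q2_eq0.
Qed.

Theorem theorem4 (R : realType) (m n a b : nat)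
    (hnm : n = (2 * m)%N) (hn : (3 < n)%N)
    (ha : (1 <= a)%N) (hab : (a < b)%N) (hb : (b <= n - 1)%N)
    (hgcd : (2 < gcdn (a + b) n)%N) :
  ~ represents_with_axes R (alternating_sides n a b) m.
Proof.
case=> s [hs _].
by apply: (@alternating_sides_not_represents n a b s) hs => //; apply: ltn_trans hn.
Qed.
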